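(* The complete graph $K_8$ satisfies $\operatorname{area}(K_8)=100$ and $\operatorname{perim}(K_8)=40$.
   Context: An integer rectangle is a set $[x_1,x_2]\times[y_1,y_2]$ with $x_1<x_2$, $y_1<y_2$ integers. Let $S$ be a finite set of integer rectangles with pairwise disjoint interiors (rectangles may share boundary edges). Two rectangles $A,B\in S$ see each other if there is a vertical or horizontal line segment that intersects the interiors of both $A$ and $B$ and intersects no other (closed) rectangle of $S$. $S$ is an RV-representation of a graph $G$ if the vertices of $G$ correspond bijectively to the rectangles of $S$ so that two vertices are adjacent if and only if their rectangles see each other. The bounding box of $S$ is the smallest axis-parallel rectangle containing all rectangles of $S$. $\operatorname{area}(G)$ and $\operatorname{perim}(G)$ (the perimeter of $G$) are the minimum area and minimum perimeter, respectively, of the bounding box, each minimum being taken separately over all RV-representations of $G$. *)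

(* Defs.v *)
From HB Require Import structures.
From mathcomp Require Import all_boot all_order all_algebra.
From mathcomp Require Import all_classical all_reals all_analysis.
Set Implicit Arguments.
Unset Strict Implicit.
Unset Printing Implicit Defensive.
Import Order.TTheory GRing.Theory Num.Theory.
Import numFieldNormedType.Exports.
Local Open Scope classical_set_scope.
Local Open Scope ring_scope.

Record sgraph (V : finType) := SGraph {
  adj :> rel V;
  adj_sym : symmetric adj;
  adj_irr : irreflexive adj }.

Definition neq_rel (V : finType) : rel V := fun u v => u != v.

Lemma neq_rel_sym (V : finType) : symmetric (@neq_rel V).
Proof. by move=> u v; rewrite /neq_rel eq_sym. Qed.

Lemma neq_rel_irr (V : finType) : irreflexive (@neq_rel V).
Proof. by move=> u; rewrite /neq_rel eqxx. Qed.

Definition complete_graph (n : nat) : sgraph 'I_n :=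
  SGraph (@neq_rel_sym 'I_n) (@neq_rel_irr 'I_n).

(* Rectangles have real coordinates so that the bounding box can be smallest
   among all axis-parallel rectangles; [integer_rect] selects the integer ones. *)
Record rect (R : realType) := Rect {
  x1 : R; x2 : R; y1 : R; y2 : R;
  ltx : x1 < x2;
  lty : y1 < y2 }.

Section Rectangles.
Variable R : realType.
Implicit Types (A B : rect R) (S : set (rect R)).

Definition region A : set (R * R) :=
  `[x1 A, x2 A]%classic `*` `[y1 A, y2 A]%classic.

Definition integer_rect A : Prop :=
  [/\ x1 A \is a Num.int, x2 A \is a Num.int,
      y1 A \is a Num.int & y2 A \is a Num.int].

Definition rect_area A : R := (x2 A - x1 A) * (y2 A - y1 A).

Definition rect_perim A : R := 2 * ((x2 A - x1 A) + (y2 A - y1 A)).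

Definition axis_segment (s : set (R * R)) : Prop :=
  exists a b c : R, a <= b /\
    (s = `[a, b]%classic `*` [set c] \/ s = [set c] `*` `[a, b]%classic).

Definition sees S A B : Prop :=
  exists s, [/\ axis_segment s,
    s `&` (region A)° !=set0,
    s `&` (region B)° !=set0 &
    forall C, S C -> C <> A -> C <> B -> s `&` region C = set0].

Definition RV_representation (V : finType) (G : sgraph V)
    (S : set (rect R)) : Prop :=
  [/\ finite_set S,
      forall A, S A -> integer_rect A,
      trivIset S (fun A => (region A)°) &
      exists f : V -> rect R, set_bij [set: V] S f /\
        forall u v, u != v -> (G u v <-> sees S (f u) (f v))].

Definition bounding_box S B : Prop :=
  (forall A, S A -> region A `<=` region B) /\
  (forall B', (forall A, S A -> region A `<=` region B') ->
    region B `<=` region B').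

Definition is_minimum (E : set R) (m : R) : Prop := E m /\ lbound E m.

(* [is_area G m] reads area(G) = m, and likewise for [is_perim]. *)
Definition is_area (V : finType) (G : sgraph V) (m : R) : Prop :=
  is_minimum [set a | exists S B,
    [/\ RV_representation G S, bounding_box S B & a = rect_area B]] m.

Definition is_perim (V : finType) (G : sgraph V) (m : R) : Prop :=
  is_minimum [set p | exists S B,
    [/\ RV_representation G S, bounding_box S B & p = rect_perim B]] m.

End Rectangles.

(* Main.v *)
Require Import Defs.
From mathcomp Require Import all_boot all_order all_algebra.
From mathcomp Require Import all_classical all_reals all_analysis.
From mathcomp Require Import zify lra.
Set Implicit Arguments.
Unset Strict Implicit.
Unset Printing Implicit Defensive.
Import Order.TTheory GRing.Theory Num.Theory.
Import numFieldNormedType.Exports.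
Local Open Scope ring_scope.

(** Every representation of K_8 is at least 10 wide and at least 10 high, and a
pinwheel arrangement fits in a 10 by 10 box; this gives both minima at once.

Two rectangles with disjoint interiors that see each other vertically have
overlapping x-projections and disjoint y-projections, and conversely for
horizontal sight.  So in a representation of a complete graph each pair overlaps
in exactly one of the two projections: the graphs V (x-overlap) and H (y-overlap)
are complementary interval graphs, and overlapping in x already implies seeing
each other vertically.

No five rectangles are pairwise x-overlapping ([clique_le4]): they would be
stacked over a common column, and the five columns of sight that skip some
stacked rectangle would have to lie alternately left and right of it around an
odd cycle.  As complementary interval graphs, V and H are split graphs
([split_layout]): here this means four beams a1, ..., a4 stacked over a column
x0, and four posts b placed side by side along a row y0.  Maximality of the two
4-cliques shows that each beam x-overlaps some post, that each post y-overlaps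
some beam, and that the beams avoid y0 and the posts avoid x0 ([cross_exists]).

The columns c13 (through a1, a3, missing a2) and c24 (through a2, a4, missing a3)
lie on opposite sides of x0.  From this a2 lies below y0 and a3 above it
([lower_inner]), and a post x-overlapping a2 is on the side of x0 opposite to c13
and is at least two columns wide ([wide_post]); turning the picture upside down,
a post x-overlapping a3 is on the other side and also two columns wide.  The columns
x0, c13, c24 and a column c14 through a1, a4 missing a2, a3 are distinct and free
of posts, while the four posts, which do not share columns, occupy at least
2 + 2 + 1 + 1 of them: ten columns in total ([ten_columns]).  Exchanging the
coordinates gives ten rows. *)

(** * Integer layouts and their lines of sight *)

(** The corners of a family of integer rectangles.  Cutting the plane into unit
columns and rows, the rectangle [i] occupies the columns [c] (standing for the
strip between [c] and [c + 1]) with [xl i <= c < xr i].  Every notion below that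
concerns rows is the column notion of the transposed layout. *)
Record layout (T : Type) := Layout {
  xl : T -> int; xr : T -> int; yl : T -> int; yr : T -> int }.

Definition transpose (T : Type) (L : layout T) := Layout (yl L) (yr L) (xl L) (xr L).

Definition flip (T : Type) (L : layout T) :=
  Layout (xl L) (xr L) (fun i => - yr L i) (fun i => - yl L i).

Definition in_col (T : Type) (L : layout T) i c := (xl L i <= c) && (c < xr L i).
Definition x_overlap (T : Type) (L : layout T) i j :=
  (xl L i < xr L j) && (xl L j < xr L i).
Definition y_overlap (T : Type) (L : layout T) := x_overlap (transpose L).
(** Heights only: it expresses an obstruction for rectangles sharing a column. *)
Definition between (T : Type) (L : layout T) i k j :=
  (yr L i <= yl L k) && (yr L k <= yl L j).
(** Sight along a unit column.  [k] ranges over all indices, as a rectangle of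
positive height is never between itself and another one. *)
Definition col_sees (T : Type) (L : layout T) i j := exists c,
  [/\ in_col L i c, in_col L j c &
      forall k, in_col L k c -> ~~ between L i k j && ~~ between L j k i].

(** The integer form of a representation of a complete graph. *)
Record complete (T : finType) (L : layout T) : Prop := Complete {
  complete_x : forall i, xl L i < xr L i;
  complete_y : forall i, yl L i < yr L i;
  complete_disjoint : forall i j, i != j -> ~~ (x_overlap L i j && y_overlap L i j);
  complete_sees : forall i j, i != j ->
    col_sees L i j \/ col_sees (transpose L) i j }.

Section Complete.
Variables (T : finType).
Implicit Types (L : layout T) (i j k a b : T) (s t : seq T).

Lemma complete_transpose L : complete L -> complete (transpose L).
Proof.
case=> hx hy hd hs; split=> // i j ij; first by rewrite andbC; exact: hd.
by case: (hs i j ij); [right|left].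
Qed.

Lemma complete_flip L : complete L -> complete (flip L).
Proof.
case=> hx hy hd hs; split=> // [i|i j ij|i j ij].
- by have /= := hy i; lia.
- by have := hd i j ij; rewrite /y_overlap /x_overlap /=; lia.
case: (hs i j ij) => -[c [ci cj ck]]; [left; exists c | right; exists (- c - 1)].
  split=> // k /ck; rewrite /between /=; lia.
move: ci cj; rewrite /in_col /= => ci cj; split; [lia|lia|] => k kc.
by apply: ck; move: kc; rewrite /in_col /=; lia.
Qed.

Lemma in_col_x_overlap L i j c : in_col L i c -> in_col L j c -> x_overlap L i j.
Proof. rewrite /in_col /x_overlap; lia. Qed.

(** Starting from the common column [c] and moving to one side, one of the two
intervals ends no later than the other; so the columns in which only [i],
respectively only [j], is present cannot be on the same side of [c]. *)
Lemma opposite_sides L c i j ci cj : in_col L i c -> in_col L j c ->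
  in_col L i ci -> ~~ in_col L j ci -> in_col L j cj -> ~~ in_col L i cj ->
  (ci < c) = ~~ (cj < c).
Proof. rewrite /in_col; clear; lia. Qed.

Lemma x_overlap_in_col L i j : complete L -> x_overlap L i j ->
  exists2 c, in_col L i c & in_col L j c.
Proof.
move=> cL; have [hi hj] := (complete_x cL i, complete_x cL j).
rewrite /x_overlap /in_col => ij; have [le|lt] := leP (xl L i) (xl L j).
  by exists (xl L j); lia.
by exists (xl L i); lia.
Qed.

Lemma y_overlapE L i j : complete L -> i != j -> y_overlap L i j = ~~ x_overlap L i j.
Proof.
move=> cL ij; have /= := complete_disjoint cL ij.
case: (complete_sees cL ij) => -[c [ci cj _]].
  by rewrite (in_col_x_overlap ci cj) => /negPf.
by rewrite /y_overlap (in_col_x_overlap ci cj) andbT => ->.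
Qed.

(** Two rectangles meeting a column are disjoint in y, hence have no horizontal
line of sight, so a vertical one must exist. *)
Lemma clear_column L c i j : complete L ->
  in_col L i c -> in_col L j c -> yr L i <= yl L j ->
  exists c', [/\ in_col L i c', in_col L j c' &
    forall k, between L i k j -> ~~ in_col L k c'].
Proof.
move=> cL ic jc le_ij.
have ij : i != j by apply: contraTneq le_ij => ->; rewrite -ltNge complete_y.
case: (complete_sees cL ij) => -[c' [ci cj ck]].
  by exists c'; split=> // k ikj; apply/negP => /ck; rewrite ikj.
have := in_col_x_overlap ci cj.
by rewrite -/(y_overlap L i j) (y_overlapE cL ij) (in_col_x_overlap ic jc).
Qed.

Definition stacked L := sorted (fun i j => yr L i <= yl L j).

(** Disjoint rectangles over one column are linearly ordered by height. *)
Lemma stack_column L c s : complete L -> uniq s -> all (in_col L ^~ c) s ->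
  exists2 t, perm_eq s t & stacked L t.
Proof.
move=> cL us sc.
(* Totality of the order fails off the column, and reflexivity needs [i == j]. *)
pose le i j := (i == j) || (yr L i <= yl L j).
exists (sort le s); first by rewrite perm_sym perm_sort.
have tot : {in in_col L ^~ c &, total le}.
  move=> i j ic jc; rewrite /le; case: eqVneq => //= ij.
  have := complete_disjoint cL ij; rewrite (in_col_x_overlap ic jc).
  by rewrite /y_overlap /x_overlap /=; lia.
have st := sort_sorted_in tot sc.
have ut : uniq (sort le s) by rewrite sort_uniq.
move: st ut; case: (sort le s) => //= x t.
elim: t x => //= y t IH x /andP[xy yt] /andP[nx uy].
rewrite IH // andbT.
by move: xy nx; rewrite /le inE negb_or; case: eqVneq.
Qed.

(** The one-dimensional Helly theorem; the column is the rightmost left end. *)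
Lemma helly L s : (forall i, xl L i < xr L i) ->
  {in s &, forall i j, x_overlap L i j} ->
  exists c, all (in_col L ^~ c) s.
Proof.
move=> hx; case: s => [|i0 s] h; first by exists 0.
have i0s : i0 \in i0 :: s by rewrite mem_head.
case: (@arg_maxP _ _ _ i0 [in i0 :: s] (xl L) i0s) => m ms mmax.
exists (xl L m); apply/allP => i is_.
by have := h _ _ is_ ms; have := mmax i is_; rewrite /in_col /x_overlap /=; lia.
Qed.

(** Each of the pairs 13, 24, 35, 14, 25 has a line of sight, in a column missed by
the rectangles in between.  By [opposite_sides] the columns of the pairs that are
consecutive in the cyclic order 14, 25, 13, 24, 35 lie on opposite sides of [c],
which is impossible around a cycle of odd length. *)
Lemma no_stack5 L c a1 a2 a3 a4 a5 : complete L ->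
  all (in_col L ^~ c) [:: a1; a2; a3; a4; a5] ->
  ~~ stacked L [:: a1; a2; a3; a4; a5].
Proof.
move=> cL /= /and5P[h1 h2 h3 h4 /andP[h5 _]]; apply/negP => /and5P[s1 s2 s3 s4 _].
have y := complete_y cL.
have [y2 y3 y4] := And3 (y a2) (y a3) (y a4).
have b123 : between L a1 a2 a3 by rewrite /between s1.
have b234 : between L a2 a3 a4 by rewrite /between s2.
have b345 : between L a3 a4 a5 by rewrite /between s3.
have b124 : between L a1 a2 a4 by rewrite /between; move: s1 s2 s3 y3; clear; lia.
have b134 : between L a1 a3 a4 by rewrite /between; move: s1 s2 s3 y2; clear; lia.
have b235 : between L a2 a3 a5 by rewrite /between; move: s2 s3 s4 y4; clear; lia.
have b245 : between L a2 a4 a5 by rewrite /between; move: s2 s3 s4 y3; clear; lia.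
have l13 : yr L a1 <= yl L a3 by move: s1 s2 y2; clear; lia.
have l24 : yr L a2 <= yl L a4 by move: s2 s3 y3; clear; lia.
have l35 : yr L a3 <= yl L a5 by move: s3 s4 y4; clear; lia.
have l14 : yr L a1 <= yl L a4 by move: l13 s3 y3; clear; lia.
have l25 : yr L a2 <= yl L a5 by move: l24 s4 y4; clear; lia.
have [c13 [p1 p3 /(_ _ b123) p2]] := clear_column cL h1 h3 l13.
have [c24 [q2 q4 /(_ _ b234) q3]] := clear_column cL h2 h4 l24.
have [c35 [r3 r5 /(_ _ b345) r4]] := clear_column cL h3 h5 l35.
have [c14 [t1 t4 tb]] := clear_column cL h1 h4 l14.
have [c25 [u2 u5 ub]] := clear_column cL h2 h5 l25.
have [t2 t3 u3 u4] := And4 (tb _ b124) (tb _ b134) (ub _ b235) (ub _ b245).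
have := opposite_sides h4 h2 t4 t2 u2 u4.
have := opposite_sides h2 h3 u2 u3 p3 p2.
have := opposite_sides h3 h2 p3 p2 q2 q3.
have := opposite_sides h4 h3 q4 q3 r3 r4.
have := opposite_sides h3 h4 r3 r4 t4 t3.
by do 5 case: (_ < c).
Qed.

(** A visibility graph of horizontal bars is planar, so it contains no K_5; here
Helly's theorem provides a common column, which allows the elementary argument
of [no_stack5]. *)
Lemma clique_le4 L s : complete L -> uniq s -> {in s &, forall i j, x_overlap L i j} ->
  (size s <= 4)%N.
Proof.
move=> cL us h; rewrite leqNgt; apply/negP => s5.
have [c sc] := helly (complete_x cL) h.
have u5 : uniq (take 5 s) by rewrite take_uniq.
have c5 : all (in_col L ^~ c) (take 5 s) by exact/allP/(sub_in1 _ (allP sc))/mem_take.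
have [t pt st] := stack_column cL u5 c5.
have zt : size t = 5%N by rewrite -(perm_size pt) size_takel.
move: st zt c5; rewrite (perm_all _ pt).
case: t {pt} => [|a1 [|a2 [|a3 [|a4 [|a5 [|? ?]]]]]] // st _ ct.
by move/negP: (no_stack5 cL ct).
Qed.

(** An interval that meets two disjoint intervals covers the gap between them. *)
Lemma y_overlap_both_sides L i j p q : yr L p <= yl L q ->
  y_overlap L i p -> y_overlap L i q -> y_overlap L j p -> y_overlap L j q ->
  y_overlap L i j.
Proof. rewrite /y_overlap /x_overlap /=; clear; lia. Qed.

Lemma clique_set_le4 L (K : {set T}) : complete L ->
  {in K &, forall i j, x_overlap L i j} -> (#|K| <= 4)%N.
Proof.
move=> cL h; rewrite cardE; apply: (clique_le4 cL) (enum_uniq _) _ => i j.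
by rewrite !mem_enum; exact: h.
Qed.

(** Among the x-overlapping pairs take a pair [p], [q] whose later right end [m] is
smallest, and let the clique consist of the rectangles meeting column [m - 1].  The
others end by [m - 1] or start at [m] or later.  Two of the former do not
x-overlap, by minimality.  Each of the latter is right of [p] and [q], so it
y-overlaps both; as [p] and [q] are disjoint in y, any two of the latter
y-overlap by [y_overlap_both_sides].  Finally one of the former and one of the
latter do not x-overlap.  So the complement is pairwise y-overlapping, and both
parts have at most four elements. *)
Lemma split_layout L : complete L -> #|T| = 8%N ->
  exists x0 (K : {set T}), [/\ #|K| = 4%N, #|~: K| = 4%N,
    {in K, forall i, in_col L i x0} & {in ~: K &, forall i j, y_overlap L i j}].
Proof.
move=> cL T8.
pose P (u : T * T) := (u.1 != u.2) && x_overlap L u.1 u.2.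
have yovii i : y_overlap L i i by rewrite /y_overlap /x_overlap /= (complete_y cL).
have [u0 Pu0|noP] := pickP P; last first.
  have : (#|[set: T]| <= 4)%N.
    apply: (clique_set_le4 (complete_transpose cL)) => i j _ _.
    have [->|ij] := eqVneq i j; first exact: yovii.
    have /= := noP (i, j); rewrite /P /= ij.
    by rewrite -/(y_overlap L i j) (y_overlapE cL ij) /= => ->.
  by rewrite cardsT T8.
case: (@arg_minP _ _ _ u0 P (fun u => Num.max (xr L u.1) (xr L u.2)) Pu0).
move=> [p q] /andP[/= pq xpq] mmin; set m := Num.max (xr L p) (xr L q) in mmin.
have [pm qm] : xr L p <= m /\ xr L q <= m by rewrite /m; clear; lia.
pose K := [set i | in_col L i (m - 1)]; exists (m - 1), K.
have KP : {in K, forall i, in_col L i (m - 1)} by move=> i; rewrite inE.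
have IP : {in ~: K &, forall i j, y_overlap L i j}.
  have half i j : i != j -> i \notin K -> j \notin K -> xr L i <= m - 1 ->
      y_overlap L i j.
    move=> ij iK jK im; rewrite (y_overlapE cL ij); apply/negP => xij.
    have [jm|mj] := boolP (xr L j <= m - 1).
      have /mmin /= : P (i, j) by rewrite /P /= ij.
      by move: im jm; clear; lia.
    by move: xij jK mj im; rewrite inE /in_col /x_overlap; clear; lia.
  have far i k : m - 1 < xl L i -> xr L k <= m -> y_overlap L i k.
    have [-> _ _|ik] := eqVneq i k; first exact: yovii.
    by rewrite (y_overlapE cL ik) /x_overlap; clear; lia.
  move=> i j; rewrite !finset.in_setC => iK jK.
  have [->|ij] := eqVneq i j; first exact: yovii.
  have [im|mi] := boolP (xr L i <= m - 1); first exact: half.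
  have [jm|mj] := boolP (xr L j <= m - 1).
    by rewrite /y_overlap /x_overlap andbC; apply: half => //; rewrite eq_sym.
  have {}mi : m - 1 < xl L i by move: iK mi; rewrite inE /in_col; clear; lia.
  have {}mj : m - 1 < xl L j by move: jK mj; rewrite inE /in_col; clear; lia.
  have [ip iq jp jq] := 
    And4 (far i p mi pm) (far i q mi qm) (far j p mj pm) (far j q mj qm).
  have : ~~ y_overlap L p q by rewrite (y_overlapE cL pq) xpq.
  have [le_pq _|lt_qp] := boolP (yr L p <= yl L q).
    exact: y_overlap_both_sides le_pq ip iq jp jq.
  have [le_qp _|lt_pq] := boolP (yr L q <= yl L p).
    exact: y_overlap_both_sides le_qp iq ip jq jp.
  by move: lt_qp lt_pq; rewrite /y_overlap /x_overlap /=; clear; lia.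
have K4 : (#|K| <= 4)%N.
  by apply: (clique_set_le4 cL) => i j /KP hi /KP hj; exact: in_col_x_overlap hi hj.
have I4 : (#|~: K| <= 4)%N by exact: (clique_set_le4 (complete_transpose cL)).
by have := cardsC K; rewrite T8 => KC; split=> //; move: K4 I4 KC; clear; lia.
Qed.

(** * Four beams crossed by four posts *)

(** The beams [a1], ..., [a4] are stacked upwards over the column [x0]; the posts in
[B] stand side by side, all crossing the row [y0].  A beam and a post are said to
meet if they x-overlap, and the post reaches the beam if they y-overlap. *)
Record cross L a1 a2 a3 a4 (B : {set T}) (x0 y0 : int) : Prop := Cross {
  cross_col : {in [:: a1; a2; a3; a4], forall a, in_col L a x0};
  cross_stack : stacked L [:: a1; a2; a3; a4];
  cross_row : {in B, forall b, in_col (transpose L) b y0};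
  cross_off : {in [:: a1; a2; a3; a4], forall a, ~~ in_col (transpose L) a y0};
  cross_meets_post : {in [:: a1; a2; a3; a4], forall a,
    exists2 b, b \in B & x_overlap L a b};
  cross_reaches_beam : {in B, forall b,
    exists2 a, a \in [:: a1; a2; a3; a4] & y_overlap L a b} }.

Lemma in_col_same_side L b c p q : ~~ in_col L b c ->
  in_col L b p -> in_col L b q -> (p < c) = (q < c).
Proof. rewrite /in_col; clear; lia. Qed.

Lemma in_col_neq L b c d : in_col L b c -> ~~ in_col L b d -> c != d.
Proof. by move=> bc; apply: contraNneq => <-. Qed.

(** A post starts from the row [y], so in order to reach the height of a far beam it
has to pass the height of every nearer beam on the same side of [y]. *)
Lemma y_overlap_nearer_up L a a' b y : complete L -> y < yl L a -> yr L a <= yl L a' ->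
  in_col (transpose L) b y -> y_overlap L a' b -> y_overlap L a b.
Proof.
move=> cL; move: (complete_y cL a).
by rewrite /in_col /y_overlap /x_overlap /=; clear; lia.
Qed.

Lemma y_overlap_nearer_down L a a' b y : complete L -> yr L a <= y ->
  yr L a' <= yl L a ->
  in_col (transpose L) b y -> y_overlap L a' b -> y_overlap L a b.
Proof.
move=> cL; move: (complete_y cL a).
by rewrite /in_col /y_overlap /x_overlap /=; clear; lia.
Qed.

Lemma above_of_not_y_overlap L a b y : complete L -> y < yl L a ->
  in_col (transpose L) b y ->
  ~~ y_overlap L a b -> yr L b <= yl L a.
Proof.
move=> cL; move: (complete_y cL a).
by rewrite /in_col /y_overlap /x_overlap /=; clear; lia.
Qed.

Lemma below_of_not_y_overlap L a b y : complete L -> yr L a <= y ->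
  in_col (transpose L) b y ->
  ~~ y_overlap L a b -> yr L a <= yl L b.
Proof.
move=> cL; move: (complete_y cL a).
by rewrite /in_col /y_overlap /x_overlap /=; clear; lia.
Qed.

Lemma above_or_below L a y : ~~ in_col (transpose L) a y ->
  (yr L a <= y) || (y < yl L a).
Proof. rewrite /in_col /=; lia. Qed.

(** Turning the picture upside down exchanges the roles of [a2] and [a3]; the new
row is [- y0 - 1] because a row is named by its lower edge. *)
Lemma cross_flip L a1 a2 a3 a4 B x0 y0 : cross L a1 a2 a3 a4 B x0 y0 ->
  cross (flip L) a4 a3 a2 a1 B x0 (- y0 - 1).
Proof.
have sub a : a \in [:: a4; a3; a2; a1] -> a \in [:: a1; a2; a3; a4].
  by rewrite -[[:: a4; _; _; _]]/(rev [:: a1; a2; a3; a4]) mem_rev.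
case=> hc hs hr ho hx hy; split.
- by move=> a /sub /hc.
- by move: hs; rewrite /stacked /=; clear; lia.
- by move=> b /hr; rewrite /in_col /=; clear; lia.
- by move=> a /sub /ho; rewrite /in_col /=; clear; lia.
- by move=> a /sub /hx.
move=> b /hy[a ha ab]; exists a.
  by rewrite -[[:: a4; _; _; _]]/(rev [:: a1; a2; a3; a4]) mem_rev.
by move: ab; rewrite /y_overlap /x_overlap /=; clear; lia.
Qed.

Section Cross.
Variables (L : layout T) (cL : complete L).
Variables (a1 a2 a3 a4 : T) (B : {set T}) (x0 y0 : int).
Hypothesis X : cross L a1 a2 a3 a4 B x0 y0.

Let A1 : a1 \in [:: a1; a2; a3; a4]. Proof. by rewrite !inE eqxx. Qed.
Let A2 : a2 \in [:: a1; a2; a3; a4]. Proof. by rewrite !inE eqxx !orbT. Qed.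
Let A3 : a3 \in [:: a1; a2; a3; a4]. Proof. by rewrite !inE eqxx !orbT. Qed.
Let A4 : a4 \in [:: a1; a2; a3; a4]. Proof. by rewrite !inE eqxx !orbT. Qed.

Lemma cross_y_overlapE a b : a \in [:: a1; a2; a3; a4] -> b \in B ->
  y_overlap L a b = ~~ x_overlap L a b.
Proof.
move=> ha hb; apply: y_overlapE cL _.
by apply: contraNneq (cross_off X ha) => ->; exact: (cross_row X).
Qed.

(** A post in the column [x0] would meet all beams, hence reach none. *)
Lemma cross_center_free b : b \in B -> ~~ in_col L b x0.
Proof.
move=> hb; apply/negP => bx0; have [a ha] := cross_reaches_beam X hb.
by rewrite (cross_y_overlapE ha hb) (in_col_x_overlap (cross_col X ha) bx0).
Qed.

(** In a column shared with [i] and [j], a post can only be between them, since it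
meets the row [y0]; there it would block the line of sight. *)
Lemma cross_between_free i j c : i \in [:: a1; a2; a3; a4] ->
  j \in [:: a1; a2; a3; a4] -> yr L i <= y0 -> y0 < yl L j ->
  in_col L i c -> in_col L j c ->
  (forall k, between L i k j -> ~~ in_col L k c) ->
  {in B, forall b, ~~ in_col L b c}.
Proof.
move=> hi hj iy yj ic jc clr b hb; apply/negP => bc.
have by0 := cross_row X hb.
have ib : ~~ y_overlap L i b by rewrite cross_y_overlapE // (in_col_x_overlap ic bc).
have jb : ~~ y_overlap L j b by rewrite cross_y_overlapE // (in_col_x_overlap jc bc).
have /clr : between L i b j.
  by rewrite /between (below_of_not_y_overlap cL iy by0 ib)
    (above_of_not_y_overlap cL yj by0 jb).
by rewrite bc.
Qed.

Lemma stack_heights : [/\ yr L a1 <= yl L a2, yr L a2 <= yl L a3,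
  yr L a3 <= yl L a4, yr L a1 <= yl L a3 & yr L a2 <= yl L a4].
Proof.
have /and4P[s1 s2 s3 _] := cross_stack X; split=> //.
  by move: s1 s2 (complete_y cL a2); clear; lia.
by move: s2 s3 (complete_y cL a3); clear; lia.
Qed.

Lemma opposite_columns :
  (exists c, [/\ in_col L a1 c, in_col L a3 c, ~~ in_col L a2 c &
     forall k, between L a1 k a3 -> ~~ in_col L k c]) /\
  (exists c, [/\ in_col L a2 c, in_col L a4 c, ~~ in_col L a3 c &
     forall k, between L a2 k a4 -> ~~ in_col L k c]).
Proof.
have [s12 s23 s34 s13 s24] := stack_heights.
have [c [c1 c3 cb]] := clear_column cL (cross_col X A1) (cross_col X A3) s13.
have [d [d2 d4 db]] := clear_column cL (cross_col X A2) (cross_col X A4) s24.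
split; [exists c | exists d]; split=> //.
  by apply: cb; rewrite /between s12.
by apply: db; rewrite /between s23.
Qed.

(** Suppose that [a2] is above [y0].  If [a1] is above too, a post met by [a1]
reaches no beam at all.  If [a1] is below, let [b] be a post met by [a2].
It reaches none of [a2], [a3], [a4], so it reaches [a1] only and is beyond the
end of [a1]; moreover [a3] sees [b] past the end of [a2].  Thus on the side of [b]
the beam [a1] ends before [a2], and [a2] before [a3], which excludes c13 and c24
from that side, although they are on opposite sides of [x0]. *)
Lemma lower_inner : yr L a2 <= y0.
Proof.
have [s12 s23 s34 s13 s24] := stack_heights.
have [h1 h2 h3] := And3 (cross_col X A1) (cross_col X A2) (cross_col X A3).
case/orP: (above_or_below (cross_off X A2)) => // y2; exfalso.
have up a b : a \in [:: a2; a3; a4] -> b \in B -> y_overlap L a b -> y_overlap L a2 b.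
  move=> ha hb; have by0 := cross_row X hb; move: ha; rewrite !inE.
  case/or3P=> /eqP-> //; first exact: y_overlap_nearer_up cL y2 s23 by0.
  exact: y_overlap_nearer_up cL y2 s24 by0.
case/orP: (above_or_below (cross_off X A1)) => y1; last first.
  have [b hb] := cross_meets_post X A1.
  rewrite -[x_overlap _ _ _]negbK -cross_y_overlapE //.
  case/negP; have [a ha ab] := cross_reaches_beam X hb.
  move: ha; rewrite inE => /predU1P[<- //|ha].
  exact: y_overlap_nearer_up cL y1 s12 (cross_row X hb) (up _ _ ha hb ab).
have [b hb x2b] := cross_meets_post X A2; have by0 := cross_row X hb.
have y2b : ~~ y_overlap L a2 b by rewrite cross_y_overlapE // x2b.
have x1b : ~~ x_overlap L a1 b.
  rewrite -cross_y_overlapE //; have [a ha ab] := cross_reaches_beam X hb.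
  move: ha; rewrite inE => /predU1P[<- //|ha].
  by move: y2b; rewrite (up _ _ ha hb ab).
have y3b : ~~ y_overlap L a3 b.
  by apply: contra y2b; apply: (up a3) => //; rewrite !inE eqxx orbT.
have [p p2 pb] := x_overlap_in_col cL x2b.
have x3b : x_overlap L a3 b by rewrite -[x_overlap _ _ _]negbK -cross_y_overlapE.
have [q q3 qb] := x_overlap_in_col cL x3b.
have y3 : y0 < yl L a3 by move: y2 s23 (complete_y cL a2); clear; lia.
have [e [eb e3 /(_ a2) e2]] :=
  clear_column cL qb q3 (above_of_not_y_overlap cL y3 by0 y3b).
have {}e2 : ~~ in_col L a2 e.
  by apply: e2; rewrite /between s23 (above_of_not_y_overlap cL y2 by0 y2b).
have [[c13 [u1 u3 u2 _]] [c24 [v2 v4 v3 _]]] := opposite_columns.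
have p1 : ~~ in_col L a1 p.
  by apply: contra x1b => p1; exact: in_col_x_overlap p1 pb.
have := opposite_sides h2 h3 v2 v3 u3 u2.
have := opposite_sides h2 h3 v2 v3 e3 e2.
have := opposite_sides h1 h2 u1 u2 p2 p1.
rewrite (in_col_same_side (cross_center_free hb) pb eb).
by do 3 case: (_ < x0).
Qed.

(** Let [b] be a post met by [a2].  It does not reach [a2], hence not [a1],
so it reaches [a3].  A column [p] of [a2] and [b] is missed by [a3], which puts [b]
on the side opposite to [c13].  Also [a1] sees [b] past the end of [a2], in a
second column [q] of [b]. *)
Lemma wide_post c13 : y0 < yl L a3 ->
  in_col L a3 c13 -> ~~ in_col L a2 c13 ->
  exists b p q, [/\ b \in B, in_col L b p, in_col L b q, p != q &
    (p < x0) = ~~ (c13 < x0)].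
Proof.
move=> y3 c3 c2; have y2 := lower_inner.
have [s12 s23 s34 s13 s24] := stack_heights.
have [h1 h2 h3] := And3 (cross_col X A1) (cross_col X A2) (cross_col X A3).
have [b hb x2b] := cross_meets_post X A2; have by0 := cross_row X hb.
have y2b : ~~ y_overlap L a2 b by rewrite cross_y_overlapE // x2b.
have y1b : ~~ y_overlap L a1 b.
  by apply: contra y2b; exact: y_overlap_nearer_down cL y2 s12 by0.
have y3b : y_overlap L a3 b.
  have [a] := cross_reaches_beam X hb; rewrite !inE => /or4P[] /eqP-> //.
  - by rewrite (negPf y1b).
  - by rewrite (negPf y2b).
  exact: y_overlap_nearer_up cL y3 s34 by0.
have [p p2 pb] := x_overlap_in_col cL x2b.
have p3 : ~~ in_col L a3 p.
  apply/negP => p3; move: y3b.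
  by rewrite cross_y_overlapE // (in_col_x_overlap p3 pb).
have x1b : x_overlap L a1 b by rewrite -[x_overlap _ _ _]negbK -cross_y_overlapE.
have [r r1 rb] := x_overlap_in_col cL x1b.
have y1 : yr L a1 <= y0 by move: y2 s12 (complete_y cL a2); clear; lia.
have [q [q1 qb /(_ a2) q2]] :=
  clear_column cL r1 rb (below_of_not_y_overlap cL y1 by0 y1b).
have {}q2 : ~~ in_col L a2 q.
  by apply: q2; rewrite /between s12 (below_of_not_y_overlap cL y2 by0 y2b).
exists b, p, q; split=> //; first exact: in_col_neq p2 q2.
exact: opposite_sides h2 h3 p2 p3 c3 c2.
Qed.

End Cross.

(** The extremality of the split: a beam that meets no post would form with the
four posts five pairwise y-overlapping rectangles, and a post that reaches no
beam would form with the four beams five pairwise x-overlapping ones. *)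
Lemma cross_exists L : complete L -> #|T| = 8%N ->
  exists a1 a2 a3 a4 (B : {set T}) x0 y0,
    [/\ cross L a1 a2 a3 a4 B x0 y0, #|B| = 4%N &
      {in B &, forall i j, y_overlap L i j}].
Proof.
move=> cL T8; have [x0 [K [K4 I4 KP IP]]] := split_layout cL T8.
have cT := complete_transpose cL.
have KX : {in K &, forall i j, x_overlap L i j}.
  by move=> i j /KP hi /KP hj; exact: in_col_x_overlap hi hj.
have colK : all (in_col L ^~ x0) (enum K).
  by apply/allP => i; rewrite mem_enum => /KP.
have [t pt st] := stack_column cL (enum_uniq _) colK.
have memt a : (a \in t) = (a \in K) by rewrite -(perm_mem pt) mem_enum.
have [y0 rowI] : exists y0, all (in_col (transpose L) ^~ y0) (enum (~: K)).
  apply: (@helly (transpose L)) (complete_x cT) _ => i j.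
  by rewrite !mem_enum; exact: IP.
have {}rowI : {in ~: K, forall b, in_col (transpose L) b y0}.
  by move=> b hb; apply: (allP rowI); rewrite mem_enum.
have neq a b : a \in K -> b \in ~: K -> a != b.
  by move=> aK; rewrite inE; apply: contraNneq => <-.
have meeta : {in K, forall a, exists2 b, b \in ~: K & x_overlap L a b}.
  move=> a aK; apply/exists_inP; apply: contraT.
  rewrite negb_exists_in => /forall_inP h.
  have : (#|a |: ~: K| <= 4)%N; last by rewrite cardsU1 inE aK I4.
  have hy b : b \in ~: K -> y_overlap L a b.
    by move=> hb; rewrite (y_overlapE cL (neq _ _ aK hb)) h.
  apply: (clique_set_le4 cT) => i j.
  move=> /setU1P[->|hi] /setU1P[->|hj]; [|exact: hy| |exact: IP].
    by rewrite /x_overlap /= (complete_y cL).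
  by have := hy _ hi; rewrite /y_overlap /x_overlap andbC.
have meetb : {in ~: K, forall b, exists2 a, a \in K & y_overlap L a b}.
  move=> b bI; apply/exists_inP; apply: contraT.
  rewrite negb_exists_in => /forall_inP h.
  have : (#|b |: K| <= 4)%N.
    have hx a : a \in K -> x_overlap L a b.
      by move=> ha; have := h a ha; rewrite (y_overlapE cL (neq _ _ ha bI)) negbK.
    apply: (clique_set_le4 cL) => i j.
    move=> /setU1P[->|hi] /setU1P[->|hj]; [| |exact: hx|exact: KX].
      by rewrite /x_overlap (complete_x cL).
    by have := hx _ hj; rewrite /x_overlap andbC.
  by move: bI; rewrite inE => bK; rewrite cardsU1 bK K4.
have zt : size t = 4%N by rewrite -(perm_size pt) -cardE.
move: zt memt st {pt}; case: t => [|a1 [|a2 [|a3 [|a4 [|? ?]]]]] // _ memt st.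
exists a1, a2, a3, a4, (~: K), x0, y0; split=> //; split=> //.
- by move=> a; rewrite memt => /KP.
- move=> a; rewrite memt => aK; apply/negP => ay.
  have [b hb] := meeta a aK; have := in_col_x_overlap ay (rowI b hb).
  by rewrite -/(y_overlap L a b) (y_overlapE cL (neq _ _ aK hb)) => /negP.
- by move=> a; rewrite memt => /meeta.
by move=> b /meetb[a ha ab]; exists a => //; rewrite memt.
Qed.

Lemma ten_columns L : complete L -> #|T| = 8%N ->
  exists cs : seq int, [/\ uniq cs, size cs = 10%N &
    forall c, c \in cs -> exists i, in_col L i c].
Proof.
move=> cL T8.
have [a1 [a2 [a3 [a4 [B [x0 [y0 [X B4 BY]]]]]]]] := cross_exists cL T8.
have X' := cross_flip X; have cL' := complete_flip cL.
have y2 := lower_inner cL X.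
have y3 : y0 < yl L a3 by move: (lower_inner cL' X') => /=; clear; lia.
have [s12 s23 s34 s13 s24] := stack_heights cL X.
have colX := cross_col X.
have [A1 A2 A3 A4] : [/\ a1 \in [:: a1; a2; a3; a4], a2 \in [:: a1; a2; a3; a4],
    a3 \in [:: a1; a2; a3; a4] & a4 \in [:: a1; a2; a3; a4]].
  by rewrite !inE !eqxx !orbT.
have [h1 h2 h3 h4] := And4 (colX _ A1) (colX _ A2) (colX _ A3) (colX _ A4).
have y1 : yr L a1 <= y0 by move: y2 s12 (complete_y cL a2); clear; lia.
have y4 : y0 < yl L a4 by move: y3 s34 (complete_y cL a3); clear; lia.
have [[c13 [u1 u3 u2 ub]] [c24 [v2 v4 v3 vb]]] := opposite_columns cL X.
have s14 : yr L a1 <= yl L a4 by move: y1 y4; clear; lia.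
have [c14 [w1 w4 wb]] := clear_column cL h1 h4 s14.
have w2 : ~~ in_col L a2 c14 by apply: wb; rewrite /between s12 s24.
have w3 : ~~ in_col L a3 c14 by apply: wb; rewrite /between s13 s34.
have free0 := cross_center_free cL X.
have free13 := cross_between_free cL X A1 A3 y1 y3 u1 u3 ub.
have free24 := cross_between_free cL X A2 A4 y2 y4 v2 v4 vb.
have free14 := cross_between_free cL X A1 A4 y1 y4 w1 w4 wb.
have [b [p [q [bB bp bq pq psd]]]] := wide_post cL X y3 u3 u2.
have y2' : - y0 - 1 < yl (flip L) a2 by move: y2 => /=; clear; lia.
have [b' [p' [q' [bB' bp' bq' pq' psd']]]] := wide_post cL' X' y2' v2 v3.
rewrite -/(in_col L b' p') -/(in_col L b' q') in bp' bq'.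
(* [b] is on the side of c24, and [b'] on the side of c13. *)
have bb' : b != b'.
  apply/eqP => eb; move: psd; rewrite -eb in bp'.
  rewrite (in_col_same_side (free0 _ bB) bp bp') psd'.
  by rewrite (opposite_sides h2 h3 v2 v3 u3 u2); case: (_ < x0).
have /card_gt1P[d [d' []]] : (1 < #|B :\ b :\ b'|)%N.
  have := cardsD1 b B; have := cardsD1 b' (B :\ b).
  by rewrite !inE bB bB' B4 eq_sym bb' /=; clear; lia.
rewrite !inE ![_ == b]eq_sym ![_ == b']eq_sym.
move=> /and3P[b'd bd dB] /and3P[b'd' bd' dB'] dd'.
have dis i j c : i \in B -> j \in B -> i != j -> in_col L i c -> ~~ in_col L j c.
  move=> iB jB ij ic; apply/negP => jc; have := BY i j iB jB.
  by rewrite (y_overlapE cL ij) (in_col_x_overlap ic jc).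
have [x xd] : exists c, in_col L d c.
  by exists (xl L d); rewrite /in_col lexx (complete_x cL).
have [x' xd'] : exists c, in_col L d' c.
  by exists (xl L d'); rewrite /in_col lexx (complete_x cL).
have ne i j c e : i \in B -> j \in B -> i != j -> in_col L i c -> in_col L j e ->
    c != e.
  by move=> iB jB ij ic je; apply: in_col_neq ic _; apply: dis je; rewrite 1?eq_sym.
have inB c : c \in [:: p; q; p'; q'; x; x'] -> exists2 i, i \in B & in_col L i c.
  rewrite !inE => /or3P[/eqP->|/eqP->|/or4P[] /eqP->].
  - by exists b.
  - by exists b.
  - by exists b'.
  - by exists b'.
  - by exists d.
  by exists d'.
(* No post occupies the first four columns; the other six belong to posts. *)
exists ([:: x0; c13; c24; c14] ++ [:: p; q; p'; q'; x; x']); split=> //; last first.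
  move=> c; rewrite mem_cat => /orP[|/inB[i _ ic]]; last by exists i.
  by rewrite !inE => /or4P[] /eqP->; [exists a1 | exists a1 | exists a2 | exists a1].
rewrite cat_uniq; apply/and3P; split.
- rewrite /= !inE !negb_or (in_col_neq h2 u2) (in_col_neq h3 v3) (in_col_neq h2 w2).
  by rewrite (in_col_neq u3 v3) (in_col_neq u3 w3) (in_col_neq v2 w2).
- apply/hasPn => c /inB[i iB ic]; rewrite !inE !negb_or.
  by rewrite (in_col_neq ic (free0 _ iB)) (in_col_neq ic (free13 _ iB))
    (in_col_neq ic (free24 _ iB)) (in_col_neq ic (free14 _ iB)).
rewrite /= !inE !negb_or pq pq' (ne b b' p p') // (ne b b' p q') //.
rewrite (ne b b' q p') // (ne b b' q q') // (ne b d p x) // (ne b d q x) //.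
rewrite (ne b d' p x') // (ne b d' q x') // (ne b' d p' x) // (ne b' d q' x) //.
by rewrite (ne b' d' p' x') // (ne b' d' q' x') // (ne d d' x x').
Qed.

End Complete.

Local Open Scope classical_set_scope.

(** * Lines of sight in the real plane *)

Lemma interior_setX (R : realType) (A B : set R) :
  (A `*` B)° = A° `*` B°.
Proof.
rewrite /interior predeqE => -[u v] /=; split.
  move=> [[P Q] [/= Pu Qv] PQ].
  have [Pu' Qv'] := (nbhs_singleton Pu, nbhs_singleton Qv).
  split; [apply: filterS Pu => w Pw | apply: filterS Qv => w Qw].
    by have [] := PQ (w, v) (conj Pw Qv').
  by have [] := PQ (u, w) (conj Pu' Qw).
by move=> [Au Bv]; exists (A, B).
Qed.

Lemma interior_region (R : realType) (A : rect R) :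
  (region A)° = `]x1 A, x2 A[%classic `*` `]y1 A, y2 A[%classic.
Proof. by rewrite interior_setX !interior_itv_bnd. Qed.

Lemma regionE (R : realType) (A : rect R) u v :
  region A (u, v) = [&& x1 A <= u, u <= x2 A, y1 A <= v & v <= y2 A] :> Prop.
Proof.
rewrite /region /= !in_itv /=; apply/propext.
split=> [[/andP[-> ->] /andP[-> ->]]//|].
by move=> /and4P[-> -> -> ->].
Qed.

Lemma interior_regionE (R : realType) (A : rect R) u v :
  (region A)° (u, v) = [&& x1 A < u, u < x2 A, y1 A < v & v < y2 A] :> Prop.
Proof.
rewrite interior_region /= !in_itv /=; apply/propext.
split=> [[/andP[-> ->] /andP[-> ->]]//|].
by move=> /and4P[-> -> -> ->].
Qed.

Lemma region_subP (R : realType) (A B : rect R) :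
  region A `<=` region B <->
  [/\ x1 B <= x1 A, x2 A <= x2 B, y1 B <= y1 A & y2 A <= y2 B].
Proof.
have [hx hy] := (ltW (ltx A), ltW (lty A)); split=> [AB|[h1 h2 h3 h4] [u v]].
  have /AB : region A (x1 A, y1 A) by rewrite regionE !lexx hx hy.
  have /AB : region A (x2 A, y2 A) by rewrite regionE !lexx hx hy.
  by rewrite !regionE => /and4P[? ? ? ?] /and4P[? ? ? ?]; split.
by rewrite !regionE => /and4P[? ? ? ?]; apply/and4P; split; lra.
Qed.

(** The segment between heights [a] and [b] on the vertical line at abscissa [c]
meets the interiors of [i] and [j] and no other closed rectangle. *)
Definition col_line (R : realType) (T : eqType) (L : layout T) i j (c a b : R) :=
  [/\ (xl L i)%:~R < c < (xr L i)%:~R, (xl L j)%:~R < c < (xr L j)%:~R,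
      exists2 p, a <= p <= b & (yl L i)%:~R < p < (yr L i)%:~R,
      exists2 p, a <= p <= b & (yl L j)%:~R < p < (yr L j)%:~R &
      forall k p, k != i -> k != j -> (xl L k)%:~R <= c <= (xr L k)%:~R ->
        a <= p <= b -> ~~ ((yl L k)%:~R <= p <= (yr L k)%:~R)].

(** Rounding [c] down loses nothing: a rectangle with integer sides that meets the
column of [Num.floor c] also meets the line at [c].  A rectangle between [i] and [j]
in that column would have its lower side crossed by the segment. *)
Lemma col_line_sees (R : realType) (T : eqType) (L : layout T) i j (c a b : R) :
  (forall k, yl L k < yr L k) -> col_line L i j c a b -> col_sees L i j.
Proof.
move=> hy [/andP[i1 i2] /andP[j1 j2] [p pab ip] [q qab jq] clr].
have in_floor k : in_col L k (Num.floor c) =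
    ((xl L k)%:~R <= c) && (c < (xr L k)%:~R).
  by rewrite /in_col floor_ge_int floor_lt_int.
have nb i' j' p' q' k : [set i'; j'] = [set i; j] ->
    a <= p' <= b -> a <= q' <= b -> (yl L i')%:~R < p' < (yr L i')%:~R ->
    (yl L j')%:~R < q' < (yr L j')%:~R -> in_col L k (Num.floor c) ->
    ~~ between L i' k j'.
  move=> ij p'ab q'ab ip' jq'; rewrite in_floor => /andP[k1 k2].
  apply/negP => /andP[ik kj].
  have ki' : k != i' by apply: contraTneq ik => ->; rewrite -ltNge.
  have kj' : k != j' by apply: contraTneq kj => ->; rewrite -ltNge.
  have [ki kj0] : k != i /\ k != j.
    have nk : ~ [set i; j] k by rewrite -ij => -[] /eqP; apply/negP.
    by split; apply/eqP => e; apply: nk; [left|right].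
  have kc : (xl L k)%:~R <= c <= (xr L k)%:~R by rewrite k1 ltW.
  have := clr k (yl L k)%:~R ki kj0 kc.
  rewrite lexx ler_int (ltW (hy k)) /= => /(_ _)/negP; case=> //.
  rewrite -(ler_int R) in ik; rewrite -(ler_int R) in kj.
  have := hy k; rewrite -(ltr_int R) => hk.
  by move: ip' jq' p'ab q'ab hk ik kj; clear; lra.
exists (Num.floor c); split; rewrite ?in_floor ?i2 ?j2 ?ltW //.
move=> k kc; apply/andP; split; first exact: (nb i j p q).
by apply: (nb j i q p) => //; rewrite setUC.
Qed.

(** The line runs through the middle of the column and the segment overshoots by one
half into each of the two rectangles, so that it meets no rectangle of the
neighbouring columns, and only rectangles between [i] and [j] in its own. *)
Lemma col_sees_line (R : realType) (T : finType) (L : layout T) i j :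
  complete L -> i != j -> col_sees L i j -> exists c a b : R,
   a <= b /\ col_line L i j c a b.
Proof.
move=> cL.
wlog lt_ij : i j / yr L i <= yl L j => [H ij|ij] [n [ni nj nk]].
  have [|lt_ij] := boolP (yr L i <= yl L j).
    by move=> /H; apply=> //; exists n.
  have le_ji : yr L j <= yl L i.
    have := complete_disjoint cL ij; rewrite (in_col_x_overlap ni nj).
    rewrite /y_overlap /x_overlap /=.
    by move: lt_ij; clear; lia.
  have [||c [a [b [ab [h1 h2 h3 h4 h5]]]]] := H j i le_ji; first by rewrite eq_sym.
    by exists n; split=> // k /nk; rewrite andbC.
  by exists c, a, b; do 2!split=> //; move=> k p ki kj; exact: h5.
have hi := complete_y cL i; have hj := complete_y cL j.
have half z : (z%:~R <= n%:~R + 2^-1 :> R) = (z <= n).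
  apply/idP/idP => h; last by rewrite -(ler_int R) in h; move: h; clear; lra.
  by rewrite -ltzD1 -(ltr_int R) intrD mulr1z; move: h; clear; lra.
have half' z : (n%:~R + 2^-1 <= z%:~R :> R) = (n < z).
  apply/idP/idP => h; first by rewrite -(ltr_int R); move: h; clear; lra.
  by rewrite -lezD1 -(ler_int R) intrD mulr1z in h; move: h; clear; lra.
have halfs z : (z%:~R < n%:~R + 2^-1 :> R) = (z <= n) by rewrite ltNge half' -leNgt.
have halfs' z : (n%:~R + 2^-1 < z%:~R :> R) = (n < z) by rewrite ltNge half -ltNge.
have step (y z : int) : y < z -> y%:~R + 1 <= z%:~R :> R.
  by rewrite -lezD1 -(ler_int R) intrD mulr1z.
have [ri rj] := (step _ _ hi, step _ _ hj).
have rij : (yr L i)%:~R <= (yl L j)%:~R :> R by rewrite ler_int.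
exists (n%:~R + 2^-1), ((yr L i)%:~R - 2^-1), ((yl L j)%:~R + 2^-1).
split; first by move: rij; clear; lra.
split; rewrite ?halfs ?halfs' //.
- by exists ((yr L i)%:~R - 2^-1); move: rij ri; clear; lra.
- by exists ((yl L j)%:~R + 2^-1); move: rij rj; clear; lra.
move=> k p ki kj; rewrite half half' => kn /andP[ap pb]; apply/negP => /andP[kp pk].
have dis i' : k != i' -> in_col L i' n -> yr L k <= yl L i' \/ yr L i' <= yl L k.
  move=> ki' ni'; have := complete_disjoint cL ki'.
  rewrite (in_col_x_overlap kn ni') /y_overlap /x_overlap /=.
  by move: (complete_y cL k) (complete_y cL i'); clear; lia.
have hk := complete_y cL k.
have kj' : yl L k <= yl L j.
  rewrite -ltzD1 -(ltr_int R) intrD mulr1z; move: kp pb; clear; lra.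
have ik' : yr L i <= yr L k.
  rewrite -ltzD1 -(ltr_int R) intrD mulr1z; move: pk ap; clear; lra.
have := nk k kn; rewrite /between negb_and.
move: (dis i ki ni) (dis j kj nj) kj' ik' hi hj hk; clear; lia.
Qed.

(** * Layouts realized by rectangles *)

Definition realizes (R : realType) (T : Type) (L : layout T) (f : T -> rect R) :=
  forall i, [/\ x1 (f i) = (xl L i)%:~R, x2 (f i) = (xr L i)%:~R,
    y1 (f i) = (yl L i)%:~R & y2 (f i) = (yr L i)%:~R].

Section Realizes.
Variables (R : realType) (T : finType) (L : layout T) (f : T -> rect R).
Hypothesis Lf : realizes L f.

Lemma realizes_ltx i : xl L i < xr L i.
Proof. by have [e1 e2 _ _] := Lf i; rewrite -(ltr_int R) -e1 -e2 ltx. Qed.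

Lemma realizes_lty i : yl L i < yr L i.
Proof. by have [_ _ e1 e2] := Lf i; rewrite -(ltr_int R) -e1 -e2 lty. Qed.

Lemma realizes_region i u v : region (f i) (u, v) =
  ((xl L i)%:~R <= u <= (xr L i)%:~R) && ((yl L i)%:~R <= v <= (yr L i)%:~R) :> Prop.
Proof. by have [<- <- <- <-] := Lf i; rewrite regionE -andbA. Qed.

Lemma realizes_interior i u v : (region (f i))° (u, v) =
  ((xl L i)%:~R < u < (xr L i)%:~R) && ((yl L i)%:~R < v < (yr L i)%:~R) :> Prop.
Proof. by have [<- <- <- <-] := Lf i; rewrite interior_regionE -andbA. Qed.

Lemma realizes_overlap i j :
  (region (f i))° `&` (region (f j))° !=set0 <-> x_overlap L i j && y_overlap L i j.
Proof.
have [xi yi] := (realizes_ltx i, realizes_lty i).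
have [xj yj] := (realizes_ltx j, realizes_lty j).
split=> [[[u v]] []|].
  rewrite !realizes_interior => /andP[/andP[a1 a2] /andP[a3 a4]].
  move=> /andP[/andP[b1 b2] /andP[b3 b4]].
  rewrite /y_overlap /x_overlap /= -!(ltr_int R).
  by rewrite (lt_trans a1 b2) (lt_trans b1 a2) (lt_trans a3 b4) (lt_trans b3 a4).
have mid (l r l' r' : int) : l < r -> l' < r' -> (l < r') && (l' < r) ->
    exists2 u : R, l%:~R < u < r%:~R & l'%:~R < u < r'%:~R.
  have step (y z : int) : y < z -> y%:~R + 1 <= z%:~R :> R.
    by rewrite -lezD1 -(ler_int R) intrD mulr1z.
  move=> /step h1 /step h2 /andP[/step h3 /step h4].
  have [ll|/ltW ll] := leP (l%:~R : R) l'%:~R.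
    by exists (l'%:~R + 2^-1); move: h1 h2 h3 h4 ll; clear; lra.
  by exists (l%:~R + 2^-1); move: h1 h2 h3 h4 ll; clear; lra.
rewrite /y_overlap /x_overlap /=.
move=> /andP[/(mid _ _ _ _ xi xj)[u ui uj] /(mid _ _ _ _ yi yj)[v vi vj]].
by exists (u, v); split; rewrite realizes_interior ?ui ?vi ?uj ?vj.
Qed.

Lemma seesP i j : injective f ->
  sees (range f) (f i) (f j) <-> exists c a b : R, a <= b /\
    (col_line L i j c a b \/ col_line (transpose L) i j c a b).
Proof.
move=> injf; split.
  case=> s [[a [b [c [ab sE]]]] [[u v] [si ri]] [[u' v'] [sj rj]] blk].
  have clear k w : k != i -> k != j -> s w -> ~ region (f k) w.
    move=> ki kj sw rw.
    have fk : range f (f k) by exists k.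
    have fki : f k <> f i by move/injf/eqP; apply/negP.
    have fkj : f k <> f j by move/injf/eqP; apply/negP.
    by have : (s `&` region (f k)) w by []; rewrite (blk _ fk fki fkj).
  exists c, a, b; split=> //; move: ri rj; rewrite !realizes_interior.
  move=> /andP[ui vi] /andP[uj vj].
  case: sE => sE; rewrite sE /= in_itv /= in si sj.
    have [[uab vc] [uab' vc']] := (si, sj); rewrite vc in vi; rewrite vc' in vj.
    right; split=> //=; [by exists u|by exists u'|move=> k p ki kj kc pab].
    apply/negP => kp; apply: (clear k (p, c) ki kj); first by rewrite sE /= in_itv.
    by rewrite realizes_region kp kc.
  have [[uc vab] [uc' vab']] := (si, sj); rewrite uc in ui; rewrite uc' in uj.
  left; split=> //=; [by exists v|by exists v'|move=> k p ki kj kc pab].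
  apply/negP => kp; apply: (clear k (c, p) ki kj); first by rewrite sE /= in_itv.
  by rewrite realizes_region kp kc.
move=> [c [a [b [ab [] [ci cj [p pab ip] [q qab jq] clr]]]]].
  exists ([set c] `*` `[a, b]%classic); split.
  - by exists a, b, c; split; [|right].
  - by exists (c, p); split; rewrite ?realizes_interior ?ci //= in_itv.
  - by exists (c, q); split; rewrite ?realizes_interior ?cj //= in_itv.
  move=> _ [k _ <-] ki kj; rewrite -subset0 => -[u v] [/= [-> vab]].
  rewrite in_itv /= in vab; rewrite realizes_region => /andP[kc].
  by apply/negP/clr => //; [move: ki | move: kj]; apply: contra_not_neq => ->.
exists (`[a, b]%classic `*` [set c]); split.
- by exists a, b, c; split; [|left].
- by exists (p, c); split; rewrite ?realizes_interior ?ci ?ip //= in_itv.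
- by exists (q, c); split; rewrite ?realizes_interior ?cj ?jq //= in_itv.
move=> _ [k _ <-] ki kj; rewrite -subset0 => -[u v] [/= [uab ->]].
rewrite in_itv /= in uab; rewrite realizes_region => /andP[ku kv].
by move: ku; apply/negP/clr => //; [move: ki | move: kj];
  apply: contra_not_neq => ->.
Qed.

End Realizes.

(** * Representations of complete graphs as complete layouts *)

Lemma layout_realized (R : realType) (T : finType) (L : layout T) : complete L ->
  exists f : T -> rect R, realizes L f.
Proof.
move=> cL.
have hx i : (xl L i)%:~R < (xr L i)%:~R :> R by rewrite ltr_int (complete_x cL).
have hy i : (yl L i)%:~R < (yr L i)%:~R :> R by rewrite ltr_int (complete_y cL).
by exists (fun i => Rect (hx i) (hy i)) => i; split.
Qed.

Lemma RV_representation_of_complete (R : realType) n (L : layout 'I_n)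
    (f : 'I_n -> rect R) :
  complete L -> realizes L f -> RV_representation (complete_graph n) (range f).
Proof.
move=> cL Lf.
have dis i j : i != j -> ~ ((region (f i))° `&` (region (f j))° !=set0).
  by move=> ij /(realizes_overlap Lf); apply/negP/(complete_disjoint cL).
have injf : injective f.
  move=> i j fij; apply: contrapT => /eqP/dis; apply.
  rewrite -fij; apply/(realizes_overlap Lf).
  by rewrite /y_overlap /x_overlap /= (complete_x cL) (complete_y cL).
split.
- exact: finite_image.
- by move=> _ [i _ <-]; have [e1 e2 e3 e4] := Lf i; split; rewrite ?e1 ?e2 ?e3 ?e4.
- move=> _ _ [i _ <-] [j _ <-] ij; congr f.
  by apply: contrapT => /eqP/dis; apply.
exists f; split.
  by split; [|move=> i j _ _; exact: injf|].
move=> i j ij; split=> // _; apply/(seesP Lf) => //.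
case: (complete_sees cL ij).
  move=> /(col_sees_line R cL ij)[c [a [b [ab h]]]].
  by exists c, a, b; split=> //; left.
move=> /(col_sees_line R (complete_transpose cL) ij)[c [a [b [ab h]]]].
by exists c, a, b; split=> //; right.
Qed.

Lemma RV_representation_complete (R : realType) n (S : set (rect R)) :
  RV_representation (complete_graph n) S ->
  exists (L : layout 'I_n) f, [/\ complete L, realizes L f & S = range f].
Proof.
case=> _ intS disS [f [[fS injf surjf] fsees]].
have Sf : S = range f.
  by apply/seteqP; split=> [A /surjf //|_ [i _ <-]]; exact: fS.
have {}injf : injective f by move=> i j; apply: injf; rewrite inE.
pose L := Layout (fun i => Num.floor (x1 (f i))) (fun i => Num.floor (x2 (f i)))
  (fun i => Num.floor (y1 (f i))) (fun i => Num.floor (y2 (f i))).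
have Lf : realizes L f.
  by move=> i; have [] := intS (f i) (fS i I) => *; rewrite /= !floorK.
exists L, f; split=> //; split.
- exact: realizes_ltx Lf.
- exact: realizes_lty Lf.
- move=> i j; apply: contra_neqN => /(realizes_overlap Lf) h.
  by apply: injf; apply: disS h; exact: fS.
move=> i j ij; have /(fsees i j ij) : complete_graph n i j by [].
rewrite Sf => /(seesP Lf _ _ injf)[c [a [b [_ [] h]]]]; [left|right].
  exact: col_line_sees (realizes_lty Lf) h.
exact: (@col_line_sees R _ (transpose L)) (realizes_ltx Lf) h.
Qed.

Lemma uniq_int_size (s : seq int) lo hi : lo <= hi -> uniq s ->
  (forall c, c \in s -> lo <= c < hi) -> (size s)%:Z <= hi - lo.
Proof.
move=> lohi us sb.
have inj : {in s &, injective (fun c => `|c - lo|%N)}.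
  by move=> c d /sb + /sb; clear; lia.
have um := us; rewrite -(map_inj_in_uniq inj) in um.
have sub : {subset [seq `|c - lo|%N | c <- s] <= iota 0 `|hi - lo|%N}.
  move=> _ /mapP[c /sb cb ->]; rewrite mem_iota; move: cb; clear; lia.
have := uniq_leq_size um sub; rewrite size_map size_iota.
by rewrite -lez_nat gez0_abs ?subr_ge0.
Qed.

Lemma complete8_width (R : realType) (T : finType) (L : layout T) (u v : R) :
  complete L -> #|T| = 8%N ->
  (forall i, u <= (xl L i)%:~R /\ (xr L i)%:~R <= v) -> 10 <= v - u.
Proof.
move=> cL T8 uv; have [cs [ucs zcs occ]] := ten_columns cL T8.
have box c : c \in cs -> Num.ceil u <= c < Num.floor v.
  move=> /occ[i /andP[ic ci]]; have [ui iv] := uv i.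
  apply/andP; split.
    by rewrite ceil_le_int (le_trans ui) // ler_int.
  by apply: lt_le_trans ci _; rewrite floor_ge_int.
have lohi : Num.ceil u <= Num.floor v.
  case: cs zcs {ucs occ} box => // c cs _ /(_ c (mem_head _ _)).
  by clear; lia.
have := uniq_int_size lohi ucs box; rewrite zcs -(ler_int R) intrB.
move=> h; apply: le_trans h _; apply: lerB; [exact: floor_le|exact: ceil_ge].
Qed.

(** * The bounds for K_8 and the pinwheel *)

Lemma K8_bounding_box (R : realType) (S : set (rect R)) B :
  RV_representation (complete_graph 8) S -> bounding_box S B ->
  10 <= x2 B - x1 B /\ 10 <= y2 B - y1 B.
Proof.
move=> /RV_representation_complete[L [f [cL Lf ->]]] [SB _].
have fB i : [/\ x1 B <= (xl L i)%:~R, (xr L i)%:~R <= x2 B,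
    y1 B <= (yl L i)%:~R & (yr L i)%:~R <= y2 B].
  have [<- <- <- <-] := Lf i.
  by apply/region_subP/SB; exists i.
split.
  by apply: (complete8_width cL); rewrite ?card_ord // => i; have [] := fB i.
apply: (complete8_width (complete_transpose cL)); rewrite ?card_ord // => i.
by have [] := fB i.
Qed.

(** The equality case of [ten_columns], with indices 0 to 3 for the beams from
bottom to top and 4 to 7 for the posts from left to right; quarter turns of the
square permute the four inner rectangles 1, 6, 2, 5.  The family is indexed by
numbers, not by ordinals, so that its verification computes.
<<
  3 3 3 3 3 3 3 3 3 7
  4 . . . . . . . . 7
  4 . 2 2 2 . . . . 7
  4 . 2 2 2 . 6 6 . 7
  4 . . . . . 6 6 . 7
  4 5 5 . . . 6 6 . 7
  4 5 5 . . . . . . 7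
  4 5 5 . 1 1 1 . . 7
  4 . . . 1 1 1 . . 7
  0 0 0 0 0 0 0 0 0 7
>> *)
Definition pinwheel : layout nat :=
  Layout (fun i => Posz (nth 0 [:: 0; 4; 2; 0; 0; 1; 6; 9] i)%N)
         (fun i => Posz (nth 0 [:: 9; 7; 5; 9; 1; 3; 8; 10] i)%N)
         (fun i => Posz (nth 0 [:: 0; 1; 6; 9; 1; 2; 4; 0] i)%N)
         (fun i => Posz (nth 0 [:: 1; 3; 8; 10; 9; 5; 7; 10] i)%N).

Definition relabel (T U : Type) (g : T -> U) (L : layout U) :=
  Layout (xl L \o g) (xr L \o g) (yl L \o g) (yr L \o g).

Definition pinwheel8 : layout 'I_8 := relabel (@nat_of_ord 8) pinwheel.

Definition sees_at (L : layout nat) i j c :=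
  [&& in_col L i c, in_col L j c & all (fun k => in_col L k c ==>
    ~~ between L i k j && ~~ between L j k i) (iota 0 8)].

Definition sees_below_10 (L : layout nat) i j :=
  has (fun c => sees_at L i j (Posz c)) (iota 0 10).

Lemma pinwheel_check :
  all (fun i => [&& xl pinwheel i < xr pinwheel i, yl pinwheel i < yr pinwheel i &
    all (fun j => (i == j) || ~~ (x_overlap pinwheel i j && y_overlap pinwheel i j) &&
      (sees_below_10 pinwheel i j || sees_below_10 (transpose pinwheel) i j))
    (iota 0 8)]) (iota 0 8).
Proof. by vm_compute. Qed.

Lemma complete_pinwheel8 : complete pinwheel8.
Proof.
have mem (i : 'I_8) : (i : nat) \in iota 0 8 by rewrite mem_iota ltn_ord.
have sees_ok (P : layout nat) (i j : 'I_8) : sees_below_10 P i j ->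
    col_sees (relabel (@nat_of_ord 8) P) i j.
  move=> /hasP[c _ /and3P[ic jc /allP kc]]; exists (Posz c); split=> // k.
  exact/implyP/(kc k (mem k)).
have chk (i : 'I_8) := allP pinwheel_check i (mem i).
split=> [i|i|i j ij|i j ij]; have /and3P[hx hy /allP pair] := chk i => //.
  by have /orP[/eqP/val_inj/eqP|/andP[]] := pair j (mem j); rewrite ?(negPf ij).
have /orP[/eqP/val_inj/eqP|/andP[_]] := pair j (mem j); first by rewrite (negPf ij).
by case/orP=> /sees_ok; [left|right].
Qed.

Lemma K8_representation_10x10 (R : realType) :
  exists (S : set (rect R)) B, [/\ RV_representation (complete_graph 8) S,
    bounding_box S B, x2 B - x1 B = 10 & y2 B - y1 B = 10].
Proof.
have [f Pf] := layout_realized R complete_pinwheel8.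
have lt010 : 0 < 10 :> R by rewrite ltr0n.
exists (range f), (Rect lt010 lt010); split; rewrite /= ?subr0 //.
  exact: RV_representation_of_complete complete_pinwheel8 Pf.
split=> [_ [i _ <-]|B' fB].
  apply/region_subP => /=; have [-> -> -> ->] := Pf i.
  suff /and4P[? ? ? ?] : [&& 0 <= xl pinwheel i, xr pinwheel i <= 10,
      0 <= yl pinwheel i & yr pinwheel i <= 10].
    by rewrite !ler0z -[10 : R]/((10 : int)%:~R) !ler_int; split.
  by case: i => -[|[|[|[|[|[|[|[|]]]]]]]].
(* Rectangles 0, 7 and 3 reach the four sides of the square. *)
have fB' i : region (f i) `<=` region B' by apply: fB; exists i.
have /region_subP[a1 a2 a3 a4] := fB' (Ordinal (isT : (0 < 8)%N)).
have /region_subP[b1 b2 b3 b4] := fB' (Ordinal (isT : (7 < 8)%N)).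
have /region_subP[c1 c2 c3 c4] := fB' (Ordinal (isT : (3 < 8)%N)).
move: a1 a3 b2 c4.
have [-> _ -> _] := Pf (Ordinal (isT : (0 < 8)%N)).
have [_ -> _ _] := Pf (Ordinal (isT : (7 < 8)%N)).
have [_ _ _ ->] := Pf (Ordinal (isT : (3 < 8)%N)).
by move=> *; apply/region_subP.
Qed.

Theorem corollary6p11 (R : realType) :
  is_area (complete_graph 8) (100%:R : R) /\
  is_perim (complete_graph 8) (40%:R : R).
Proof.
have [S [B [SK SB w h]]] := K8_representation_10x10 R.
split; split.
- by exists S, B; split; rewrite // /rect_area w h -natrM.
- move=> _ [S' [B' [SK' SB' ->]]]; have [w' h'] := K8_bounding_box SK' SB'.
  by rewrite (natrM _ 10 10) /rect_area; apply: ler_pM.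
- by exists S, B; split; rewrite // /rect_perim w h -natrD -natrM.
move=> _ [S' [B' [SK' SB' ->]]]; have [w' h'] := K8_bounding_box SK' SB'.
by rewrite /rect_perim; lra.
Qed.
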